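(* Let $G$ be a connected $k$-regular graph with $n$ vertices and $m$ edges, where $m\ge n$. Let $G_1$ and $G_2$ be two arbitrary graphs with $n_1\ge1$ and $n_2\ge1$ vertices, respectively. Then the Laplacian spectrum of the subdivision double join $G^S\vee(G_1^\bullet,G_2^\circ)$ consists of: (i) $\lambda_i(G_1)+n$, for $i=2,3,\ldots,n_1$; (ii) $\lambda_i(G_2)+m$, for $i=2,3,\ldots,n_2$; (iii) $\dfrac{(n_1+k+n_2+2)\pm\sqrt{(n_1+k-n_2-2)^2+4(2k-\lambda_i(G))}}{2}$, for $i=2,3,\ldots,n$; (iv) $n_2+2$, repeated $m-n$ times; (v) all the (four) roots of the equation $$\begin{aligned}\lambda\bigl(&\lambda^3-(m+n+n_1+k+n_2+2)\lambda^2+(2m+(n_1+k+n)(m+n_2+2)+nk-2k)\lambda\\&+2(n+m)k-2(n_1+k+n)m-nk(m+n_2+2)\bigr)=0.\end{aligned}$$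
   Context: All graphs are finite and simple. The Laplacian matrix of a graph $H$ is $L(H)=D(H)-A(H)$, where $A(H)$ is the adjacency matrix and $D(H)$ the diagonal matrix of vertex degrees. The Laplacian spectrum of $H$ is the list of all eigenvalues of $L(H)$ counted with multiplicity; if $H$ has $N$ vertices they are written $\lambda_1(H)\le\lambda_2(H)\le\cdots\le\lambda_N(H)$. The subdivision graph $S(G)$ is obtained from $G$ by inserting a new vertex into every edge of $G$; let $I(G)$ be the set of new vertices. The subdivision double join $G^S\vee(G_1^\bullet,G_2^\circ)$ is the graph obtained from the disjoint union of $S(G)$, $G_1$ and $G_2$ by joining every original vertex of $G$ (in $S(G)$) to every vertex of $G_1$ and every vertex of $I(G)$ to every vertex of $G_2$. *)

(* Defs.v *)
From HB Require Import structures.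
From mathcomp Require Import all_boot all_order all_algebra.
From mathcomp Require Import polyrcf complex.

Set Implicit Arguments.
Unset Strict Implicit.
Unset Printing Implicit Defensive.

Import Order.TTheory GRing.Theory Num.Theory.

Record sgraph := SGraph {
  vert :> finType;
  adj : rel vert;
  adj_sym : symmetric adj;
  adj_irrefl : irreflexive adj }.

Definition edges (G : sgraph) : {set {set G}} :=
  [set [set p.1; p.2] | p : G * G & adj p.1 p.2].

Definition deg (G : sgraph) (x : G) : nat := #|[set y : G | adj x y]|.

Definition regular (k : nat) (G : sgraph) : Prop := forall x : G, deg x = k.

(* The empty graph is not connected. *)
Definition connected (G : sgraph) : Prop :=
  (0 < #|G|)%N /\ forall x y : G, connect (@adj G) x y.

Section SubdivisionDoubleJoin.
Variables G G1 G2 : sgraph.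

Definition edge := {e : {set G} | e \in edges G}.

Definition subdivision_adj : rel (G + edge) := fun u v =>
  match u, v with
  | inl x, inr e | inr e, inl x => x \in val e
  | _, _ => false
  end.

Lemma subdivision_adj_sym : symmetric subdivision_adj.
Proof. by case=> [x|e] [y|f]. Qed.

Lemma subdivision_adj_irrefl : irreflexive subdivision_adj.
Proof. by case. Qed.

Definition subdivision : sgraph :=
  SGraph subdivision_adj_sym subdivision_adj_irrefl.

Definition sdj_adj : rel ((G + edge) + (G1 + G2)) := fun u v =>
  match u, v with
  | inl a, inl b => @adj subdivision a b
  | inr (inl a), inr (inl b) => adj a b
  | inr (inr a), inr (inr b) => adj a b
  | inl (inl _), inr (inl _) | inr (inl _), inl (inl _) => true
  | inl (inr _), inr (inr _) | inr (inr _), inl (inr _) => true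
  | _, _ => false
  end.

Lemma sdj_adj_sym : symmetric sdj_adj.
Proof.
case=> [[x|e]|[a|b]] [[y|f]|[c|d]] //=; exact: adj_sym.
Qed.

Lemma sdj_adj_irrefl : irreflexive sdj_adj.
Proof. by case=> [[x|e]|[a|b]] //=; rewrite adj_irrefl. Qed.

Definition subdivision_double_join : sgraph :=
  SGraph sdj_adj_sym sdj_adj_irrefl.

End SubdivisionDoubleJoin.

Local Open Scope ring_scope.

Section Spectrum.
Variable R : rcfType.

(* The roots of p in R, in nondecreasing order, each repeated according to its
   multiplicity. *)
Definition mroots (p : {poly R}) : seq R :=
  flatten [seq nseq (mup x p) x | x <- rootsR p].

Definition spectrum (N : nat) (A : 'M[R]_N) : seq R := mroots (char_poly A).

Lemma mroots_sorted (p : {poly R}) : sorted <=%R (mroots p).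
Proof.
have: sorted <%R (rootsR p) by exact: sorted_roots.
rewrite /mroots; elim: (rootsR p) => [//|x s IH] /= pxs.
have ps := path_sorted pxs; move: (order_path_min lt_trans pxs) => /allP xs.
have pth : path <=%R x (flatten [seq nseq (mup y p) y | y <- s]).
  rewrite path_min_sorted ?IH //; apply/allP => z /flatten_mapP[y ys].
  by rewrite mem_nseq => /andP[_ /eqP->]; apply/ltW/xs.
case: (mup x p) => [|n] /=; first exact: path_sorted pth.
by elim: n => //= n ->; rewrite lexx.
Qed.

Lemma count_mroots (p : {poly R}) x :
  p != 0 -> count_mem x (mroots p) = mup x p.
Proof.
move=> p0; have up : uniq (rootsR p) by apply: uniq_roots.
have -> : count_mem x (mroots p) = ((x \in rootsR p) * mup x p)%N.
  rewrite /mroots; elim: (rootsR p) up => [//|y s IH] /= /andP[ys us].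
  rewrite count_cat IH // count_nseq in_cons /= eq_sym.
  have [->|_] := eqVneq x y; last by rewrite mul0n.
  by rewrite (negPf ys) mul0n addn0.
have := roots_on_rootsR p0 x; rewrite in_itv /= => <-.
by case: (boolP (root p x)) => [|/mupNroot->]; rewrite ?mul1n.
Qed.

Lemma mroots_prod (s : seq R) :
  perm_eq (mroots (\prod_(x <- s) ('X - x%:P))) s.
Proof.
apply/allP => x _ /=.
by rewrite count_mroots ?monic_neq0 ?monic_prod_XsubC // mu_prod_XsubC.
Qed.

(* mroots only sees roots in R; for a symmetric matrix no complex eigenvalue is
   missed. *)
Lemma spectrum_sym (N : nat) (A : 'M[R]_N) :
  A^T = A -> char_poly A = \prod_(x <- spectrum A) ('X - x%:P).
Proof.
move=> symA; suff [s ps] : exists s : seq R, char_poly A = \prod_(x <- s) ('X - x%:P).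
  by rewrite /spectrum {1}ps; apply: perm_big; rewrite perm_sym ps mroots_prod.
pose f := real_complex R; pose B := map_mx f A.
have hermB : B \is hermsymmx.
  apply: realsym_hermsym.
    by apply/is_hermitianmxP; rewrite expr0 scale1r map_mx_id // map_trmx symA.
  by apply/mxOverP => i j; rewrite mxE complex_real.
have /hermitian_normalmx/orthomx_spectralP := hermB.
have /mxOverP := hermitian_spectral_diag_real hermB.
set d := spectral_diag B; set P := spectralmx B => dreal BE.
have charB : char_poly B = \prod_(i < N) ('X - (d 0 i)%:P).
  have Pu : P \in unitmx by exact: spectral_unit.
  have P1 : map_mx polyC (invmx P) *m map_mx polyC P = 1%:M.
    by rewrite -map_mxM mulVmx // map_mx1.
  have E : char_poly_mx B =
      map_mx polyC (invmx P) *m char_poly_mx (diag_mx d) *m map_mx polyC P.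
    rewrite /char_poly_mx mulmxBr mulmxBl -!map_mxM -BE.
    by rewrite scalar_mxC -mulmxA P1 mulmx1.
  rewrite /char_poly E !det_mulmx mulrAC -det_mulmx P1 det1 mul1r.
  rewrite -/(char_poly _) char_poly_trig ?diag_mx_is_trig //.
  by apply: eq_bigr => i _; rewrite mxE eqxx.
exists [seq complex.Re (d 0 i) | i : 'I_N].
apply: (map_poly_inj (real_complex R : {rmorphism R -> R[i]})).
rewrite map_char_poly -/f -/B charB rmorph_prod big_map big_enum /=.
apply: eq_bigr => i _.
by rewrite map_polyXsubC /= RRe_real.
Qed.

End Spectrum.

Section Laplacian.
Variables (R : rcfType) (G : sgraph).

Definition adjacency_mx : 'M[R]_#|G| :=
  \matrix_(i, j) (adj (enum_val i) (enum_val j))%:R.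

Definition degree_mx : 'M[R]_#|G| := diag_mx (\row_i (deg (enum_val i))%:R).

Definition laplacian : 'M[R]_#|G| := degree_mx - adjacency_mx.

Lemma laplacian_sym : laplacian^T = laplacian.
Proof.
rewrite /laplacian linearB /= tr_diag_mx; congr (_ - _).
by apply/matrixP => i j; rewrite !mxE adj_sym.
Qed.

Definition laplacian_spectrum : seq R := spectrum laplacian.

(* lambda_i, with i counted from 1. *)
Definition lambda (i : nat) : R := nth 0 laplacian_spectrum i.-1.

End Laplacian.

(* Main.v *)
(* Write L for the Laplacian of the join, B for the vertex-edge incidence matrix
   of G, a = x - k - n1, b = x - 2 - n2 and y = a b - 2 k. For generic x, block
   elimination turns det (x - L) into a product of determinants of the form
   det (A + t J), where J is all-ones and A J is a multiple of J; the key relation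
   is B B^T = 2 k - L(G). The outcome is
     b^(m - n) prod_(i >= 2) (y + lambda_i(G))
       prod_(i >= 2) (x - n - lambda_i(G1)) prod_(i >= 2) (x - m - lambda_i(G2))
   times the quartic, which is the characteristic polynomial of the quotient
   matrix on the cells V(G), I(G), V(G1), V(G2). Each y + lambda_i(G) is quadratic
   in x, with nonnegative discriminant because lambda_i(G) <= 2 k. Since L is
   symmetric its characteristic polynomial splits, hence so does the quartic, and
   comparing root multiplicities gives the spectrum. *)
Require Import Defs.
From mathcomp Require Import all_boot all_order all_algebra.
From mathcomp Require Import perm fingroup polyrcf ring lra zify.

Set Implicit Arguments.
Unset Strict Implicit.
Unset Printing Implicit Defensive.

Import Order.TTheory GRing.Theory Num.Theory.
Local Open Scope ring_scope.

(** * Determinants *)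

Lemma mulmx_const (R : comNzRingType) p q r (a b : R) :
  (const_mx a : 'M_(p, q)) *m (const_mx b : 'M_(q, r)) = const_mx (a * b * q%:R).
Proof.
apply/matrixP => i j; rewrite !mxE (eq_bigr (fun=> a * b)); last first.
  by move=> h _; rewrite !mxE.
by rewrite sumr_const card_ord mulr_natr.
Qed.

(** Column elimination by a unipotent block matrix. Asking for a solution [X] of [D *m X = V]
    replaces inverting [D]. *)
Lemma det_block_schur (R : comNzRingType) p q (A : 'M[R]_p) (U : 'M_(p, q))
    (V : 'M_(q, p)) (D : 'M_q) (X : 'M_(q, p)) :
  D *m X = V -> \det (block_mx A U V D) = \det (A - U *m X) * \det D.
Proof.
move=> DX; rewrite -(det_ublock _ U).
have -> : \det (block_mx A U V D)
        = \det (block_mx A U V D *m block_mx 1%:M 0 (- X) 1%:M).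
  by rewrite det_mulmx det_lblock !det1 !mulr1.
by rewrite mulmx_block !mulmx1 !mulmx0 !add0r !mulmxN DX subrr.
Qed.

Lemma det_1_add_const (R : comNzRingType) p (t : R) :
  \det (1%:M + const_mx t : 'M_p) = 1 + t * p%:R.
Proof.
pose u : 'cV[R]_p := const_mx t; pose v : 'rV[R]_p := const_mx 1.
(* The matrix [const_mx t] is the rank-one product [u *m v]. One bordered determinant is evaluated
   twice: by row elimination here, by a 1-by-1 Schur complement below. *)
have E : \det (block_mx 1%:M v (- u) 1%:M) = \det (1%:M + const_mx t : 'M_p).
  have <- : \det (block_mx 1%:M 0 u 1%:M *m block_mx 1%:M v (- u) 1%:M)
          = \det (block_mx 1%:M v (- u) 1%:M).
    by rewrite det_mulmx det_lblock !det1 !mul1r.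
  rewrite mulmx_block !mul1mx !mul0mx !addr0 mulmx1 subrr det_ublock det1 mul1r.
  by rewrite mulmx_const !mulr1 addrC.
rewrite -E (@det_block_schur _ _ _ _ _ _ _ (- u)) ?mul1mx //.
rewrite det1 mulr1 mulmxN opprK mulmx_const mul1r.
by rewrite [_ + _]mx11_scalar det_scalar1 !mxE eqxx.
Qed.

(** With J all-ones and A J = y J, the perturbation factors as A + t J = A (1 + (t/y) J). *)
Lemma det_add_const (F : fieldType) p (A : 'M[F]_p) (y t : F) : y != 0 ->
  A *m const_mx 1 = const_mx y :> 'M_(p, p) ->
  y * \det (A + const_mx t) = \det A * (y + t * p%:R).
Proof.
move=> y0 A1.
have -> : A + const_mx t = A *m (1%:M + const_mx (t / y)).
  rewrite mulmxDr mulmx1; congr (_ + _).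
  have -> : const_mx (t / y) = (t / y) *: const_mx 1 :> 'M[F]_p.
    by apply/matrixP => i j; rewrite !mxE mulr1.
  by rewrite -scalemxAr A1; apply/matrixP => i j; rewrite !mxE divfK.
rewrite det_mulmx det_1_add_const mulrCA; congr (_ * _).
by field.
Qed.

Lemma det_scalar_add_const (F : fieldType) p (a t : F) : a != 0 ->
  a * \det (a%:M + const_mx t : 'M_p) = a ^+ p * (a + t * p%:R).
Proof.
move=> a0; rewrite det_add_const ?det_scalar // mul_scalar_mx.
by apply/matrixP => i j; rewrite !mxE mulr1.
Qed.

(** Both enumerations differ by one permutation acting on rows and columns, so its sign cancels.
    This lets the join be listed cell by cell. *)
Lemma det_reindex (R : comNzRingType) (T : finType) N (h : 'I_N -> T)
    (F : T -> T -> R) : bijective h ->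
  \det (\matrix_(i < #|T|, j < #|T|) F (enum_val i) (enum_val j))
  = \det (\matrix_(i < N, j < N) F (h i) (h j)).
Proof.
move=> hb; have EN : #|T| = N by rewrite -(bij_eq_card hb) card_ord.
case: N / EN h hb => h hb.
have inj : injective (enum_rank \o h).
  by apply: inj_comp (bij_inj hb); apply: enum_rank_inj.
pose s := perm inj.
set A := \matrix_(i, j) _.
have -> : \matrix_(i, j) F (h i) (h j) = row_perm s (col_perm s A).
  by apply/matrixP => i j; rewrite !mxE !permE /= !enum_rankK.
by rewrite row_permE col_permE !det_mulmx mulrCA -det_mulmx -perm_mxM mulgV
           perm_mx1 det1 mulr1.
Qed.

(* det (x - M) for the quotient matrix
   M = [[k+n1,-k,-n1,0],[-2,2+n2,0,-n2],[-n,0,n,0],[0,-m,0,m]]. *)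
Definition quartic_val (F : comNzRingType) (k n m n1 n2 x : F) : F :=
  x * (x ^+ 3 - (m + n + n1 + k + n2 + 2) * x ^+ 2
    + (2 * m + (n1 + k + n) * (m + n2 + 2) + n * k - 2 * k) * x
    + (2 * (n + m) * k - 2 * (n1 + k + n) * m - n * k * (m + n2 + 2))).

Lemma scale_const (F : comNzRingType) p q (c t : F) :
  c *: (const_mx t : 'M_(p, q)) = const_mx (c * t).
Proof. by apply/matrixP => i j; rewrite !mxE. Qed.

(** * Block elimination for the characteristic determinant of the join *)

Section JoinDet.
Variables (F : fieldType) (n m n1 n2 : nat) (k x : F).
Variables (B : 'M[F]_(n, m)) (L : 'M[F]_n) (L1 : 'M[F]_n1) (L2 : 'M[F]_n2).

Let a := x - k - n1%:R.
Let b := x - 2 - n2%:R.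
Let y := a * b - 2 * k.

(** This is x - L for the join, with cells in the order V(G), I(G), V(G1), V(G2); adjacencies appear
    with sign +. *)
Definition join_char_mx :=
  block_mx (block_mx a%:M B B^T b%:M)
    (block_mx (const_mx 1 : 'M_(n, n1)) 0 0 (const_mx 1 : 'M_(m, n2)))
    (block_mx (const_mx 1 : 'M_(n1, n)) 0 0 (const_mx 1 : 'M_(n2, m)))
    (block_mx ((x - n%:R)%:M - L1) 0 0 ((x - m%:R)%:M - L2)).

(** Two Schur complements: the cells of G1 and G2 are eliminated first, then I(G). The nonvanishing
    hypotheses are the divisions made on the way, and the conclusion has its denominators
    cleared. *)
Lemma det_join :
  n%:R * k = 2 * m%:R ->
  B *m const_mx 1 = const_mx k :> 'M_(n, n) ->
  B *m B^T = (2 * k)%:M - L ->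
  L *m const_mx 1 = 0 :> 'M_(n, n) ->
  L1 *m const_mx 1 = 0 :> 'M_(n1, n) ->
  L2 *m const_mx 1 = 0 :> 'M_(n2, m) ->
  x - n%:R != 0 -> x - m%:R != 0 -> b != 0 -> y != 0 ->
  b * (x - m%:R) - n2%:R * m%:R != 0 ->
  y * (x - n%:R) * (x - m%:R) * b ^+ n * \det join_char_mx
  = b ^+ m * quartic_val k n%:R m%:R n1%:R n2%:R x * \det (y%:M + L)
    * \det ((x - n%:R)%:M - L1) * \det ((x - m%:R)%:M - L2).
Proof.
move=> nk B1 BBT L10 L110 L210 xn xm b0 y0 bc0.
(* Since [L1] and [L2] kill constants, eliminating their cells subtracts d J from the V(G) block and
   c J from the I(G) block. *)
pose d := n1%:R / (x - n%:R); pose c := n2%:R / (x - m%:R).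
have bcm : b - c * m%:R != 0.
  have -> : b - c * m%:R = (b * (x - m%:R) - n2%:R * m%:R) / (x - m%:R).
    by rewrite /c; field.
  by rewrite mulf_neq0 ?invr_eq0.
(* Solves t (b - c m) = c k, which makes b^-1 (B^T + t J) a solution X of (b - c J) X = B^T, because
   J B^T = k J. *)
pose t := c * k / (b - c * m%:R).
have DX p q (z : F) (M : 'M[F]_p) : z != 0 -> M *m const_mx 1 = 0 :> 'M_(p, q) ->
    (z%:M - M) *m const_mx z^-1 = const_mx 1 :> 'M_(p, q).
  move=> z0 M1; have -> : const_mx z^-1 = z^-1 *: const_mx 1 :> 'M_(p, q).
    by rewrite scale_const mulr1.
  by rewrite -scalemxAr mulmxBl M1 subr0 mul_scalar_mx scalerA mulVf // scale1r.
rewrite /join_char_mx (@det_block_schur _ _ _ _ _ _ _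
  (block_mx (const_mx (x - n%:R)^-1) 0 0 (const_mx (x - m%:R)^-1))); last first.
  by rewrite mulmx_block !mul0mx !mulmx0 !addr0 !add0r !DX.
rewrite det_ublock mulmx_block !mul0mx !mulmx0 !addr0 !add0r !mulmx_const !mul1r.
rewrite opp_block_mx add_block_mx !oppr0 !addr0.
rewrite [(_)^-1 * _]mulrC -/d [(_)^-1 * _]mulrC -/c.
have N p q (s : F) : - const_mx s = const_mx (- s) :> 'M_(p, q).
  by apply/matrixP => i j; rewrite !mxE.
have D p q (s s' : F) : const_mx s + const_mx s' = const_mx (s + s') :> 'M_(p, q).
  by apply/matrixP => i j; rewrite !mxE.
have B1T : const_mx 1 *m B^T = const_mx k :> 'M_(m, n).
  have B1c : B *m const_mx 1 = const_mx k :> 'M_(n, m).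
    apply/matrixP => i j; have /matrixP/(_ i i) := B1; rewrite !mxE => <-.
    by apply: eq_bigr => l _; rewrite !mxE.
  by rewrite -[RHS]trmx_const -B1c trmx_mul trmx_const.
rewrite !N (@det_block_schur _ _ _ _ _ _ _ (b^-1 *: (B^T + const_mx t))); last first.
  have cE (s : F) : const_mx s = s *: const_mx 1 :> 'M_(m, m).
    by rewrite scale_const mulr1.
  rewrite -scalemxAr mulmxDr !mulmxDl !mul_scalar_mx mulmx_const cE -scalemxAl B1T.
  rewrite !scale_const -addrA !D scalerDr scalerA mulVf // scale1r scale_const.
  rewrite -[RHS]addr0; congr (_ + _); apply/matrixP => i j; rewrite !mxE /t.
  by field; rewrite b0 bcm.
(* Here B B^T = 2k - L turns a - b^-1 B B^T into b^-1 (y + L); the sign of L flips. *)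
have -> : a%:M + const_mx (- d) - B *m (b^-1 *: (B^T + const_mx t))
        = b^-1 *: ((y%:M + L) + const_mx (- (d * b + t * k))).
  have Bt : B *m const_mx t = const_mx (t * k) :> 'M_(n, n).
    by rewrite -[t in LHS]mulr1 -scale_const -scalemxAr B1 scale_const.
  rewrite -scalemxAr mulmxDr BBT Bt.
  apply/matrixP => i j; rewrite !mxE /y.
  by case: (i == j); rewrite ?mulr1n ?mulr0n; field.
rewrite detZ exprVn.
have E1 : y * \det (y%:M + L + const_mx (- (d * b + t * k)))
       = \det (y%:M + L) * (y - (d * b + t * k) * n%:R).
  rewrite det_add_const ?mulNr // mulmxDl L10 addr0 mul_scalar_mx.
  by rewrite scale_const mulr1.
have E2 := @det_scalar_add_const F m b (- c) b0.
apply: (mulfI b0); move: E1 E2.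
set dL := \det (y%:M + L); set dL' := \det (y%:M + L + _).
set dJ := \det (b%:M + _); set d1 := \det _; set d2 := \det (_ - L2).
have bn : b ^+ n != 0 by rewrite expf_neq0.
move: (b ^+ n) (b ^+ m) bn => bn bm bn0 E1 E2.
transitivity ((x - n%:R) * (x - m%:R) * (y * dL') * (b * dJ) * d1 * d2).
  by field.
rewrite E1 E2.
(* The scalars by which the two reduced blocks act on constants multiply to the quartic; the
   handshake relation [nk] enters here. *)
have key : (x - n%:R) * (x - m%:R) * ((y - (d * b + t * k) * n%:R)
   * (b + - c * m%:R)) = b * quartic_val k n%:R m%:R n1%:R n2%:R x.
  have -> : (y - (d * b + t * k) * n%:R) * (b + - c * m%:R)
     = (y - d * b * n%:R) * (b - c * m%:R) - c * k * (n%:R * k).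
    by rewrite /t; field.
  rewrite nk.
  have -> : (x - n%:R) * (x - m%:R) *
    ((y - d * b * n%:R) * (b - c * m%:R) - c * k * (2 * m%:R))
    = (y * (x - n%:R) - n1%:R * b * n%:R) * (b * (x - m%:R) - n2%:R * m%:R)
      - (x - n%:R) * n2%:R * k * (2 * m%:R).
    by rewrite /d /c; field; rewrite xn xm.
  by rewrite /quartic_val /y /a /b; ring: nk.
transitivity (((x - n%:R) * (x - m%:R) * ((y - (d * b + t * k) * n%:R)
   * (b + - c * m%:R))) * dL * bm * d1 * d2).
  by ring.
by rewrite key; ring.
Qed.

End JoinDet.

(** * Laplacian eigenvalues and incidence matrices *)

Lemma sum_enum_val (V : nmodType) (T : finType) (F : T -> V) :
  \sum_(i < #|T|) F (enum_val i) = \sum_x F x.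
Proof. by rewrite -[LHS](big_enum_val (A := T)); apply: eq_bigl. Qed.

Section Degree.
Variables (R : rcfType) (G : sgraph).

Lemma deg_sum (x : G) : deg x = (\sum_y adj x y)%N.
Proof. by rewrite /deg -sum1dep_card big_mkcond. Qed.

Lemma degR (x : G) : (deg x)%:R = \sum_y (adj x y)%:R :> R.
Proof. by rewrite deg_sum natr_sum. Qed.

Lemma laplacianE i j : laplacian R G i j
  = (i == j)%:R * (deg (enum_val i))%:R - (adj (enum_val i) (enum_val j))%:R.
Proof. by rewrite !mxE mulrC mulr_natr. Qed.

Lemma laplacian_const q : laplacian R G *m const_mx 1 = 0 :> 'M_(#|G|, q).
Proof.
apply/matrixP => i j; rewrite !mxE.
under eq_bigr => l _ do rewrite [const_mx _ _ _]mxE mulr1 laplacianE.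
rewrite sumrB (bigD1 i) //= eqxx mul1r big1 => [|l /negPf]; last first.
  by rewrite eq_sym => ->; rewrite mul0r.
by rewrite (sum_enum_val (fun y : G => (adj (enum_val i) y)%:R)) -degR addr0 subrr.
Qed.

(** Eigenvectors as functions on vertices; being nonzero is stored as a positive square norm, ready
    to be cancelled from inequalities. Symmetry of [adj] converts the left eigenvector into the row
    equation. *)
Lemma laplacian_eigenvector (mu : R) : root (char_poly (laplacian R G)) mu ->
  exists2 f : G -> R, 0 < \sum_x f x ^+ 2 &
    forall x, (deg x)%:R * f x - \sum_y (adj x y)%:R * f y = mu * f x.
Proof.
rewrite -eigenvalue_root_char => /eigenvalueP[v vL v0].
pose f x := v 0 (enum_rank x); exists f.
  have [i vi] : exists i, v 0 i != 0 by apply/rV0Pn.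
  rewrite (bigD1 (enum_val i)) //= ltr_pwDl ?sumr_ge0 // => [|x _]; last exact: sqr_ge0.
  by rewrite /f enum_valK exprn_even_gt0.
move=> x; have /rowP/(_ (enum_rank x)) := vL; rewrite !mxE => <-.
have -> : \sum_j v 0 j * laplacian R G j (enum_rank x)
  = \sum_y ((y == x)%:R * (deg x)%:R * f x - (adj x y)%:R * f y).
  rewrite -[RHS]sum_enum_val; apply: eq_bigr => j _.
  rewrite laplacianE enum_rankK /f enum_valK adj_sym -(can_eq (@enum_valK G)) enum_rankK.
  by have [<-|_] := eqVneq; rewrite ?enum_valK ?mul1r ?mul0r; ring.
rewrite sumrB; congr (_ - _); rewrite (bigD1 x) //= eqxx mul1r big1 ?addr0 // => y.
by move=> /negPf->; rewrite !mul0r.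
Qed.

(** Quadratic forms of D - A (e = -1) and D + A (e = 1) as sums of squares; each edge is met in both
    orientations, whence the factor 2. *)
Lemma sum_adj_sqr (f : G -> R) (e : R) : e ^+ 2 = 1 ->
  \sum_x \sum_y (adj x y)%:R * (f x + e * f y) ^+ 2
  = 2 * \sum_x (deg x)%:R * f x ^+ 2
    + 2 * e * \sum_x f x * \sum_y (adj x y)%:R * f y.
Proof.
move=> e1.
have S1 : \sum_x \sum_y (adj x y)%:R * f x ^+ 2 = \sum_x (deg x)%:R * f x ^+ 2.
  by apply: eq_bigr => x _; rewrite degR mulr_suml.
have S2 : \sum_x \sum_y (adj x y)%:R * f y ^+ 2 = \sum_x (deg x)%:R * f x ^+ 2.
  by rewrite exchange_big /= -S1; do 2!apply: eq_bigr => ? _; rewrite adj_sym.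
rewrite mulr2n mulrDl mul1r -{1}S1 -S2 mulr_sumr -!big_split; apply: eq_bigr => x _ /=.
rewrite !mulr_sumr -!big_split; apply: eq_bigr => y _ /=.
by rewrite sqrrD exprMn e1; ring.
Qed.

(** The case e = -1: mu times the square norm is half a sum of squares. *)
Lemma laplacian_root_ge0 mu : root (char_poly (laplacian R G)) mu -> 0 <= mu.
Proof.
case/laplacian_eigenvector => f f0 Lf.
rewrite -(pmulr_lge0 _ f0).
have := @sum_adj_sqr f (-1); rewrite sqrrN expr1n => /(_ erefl) E.
have S : \sum_x (deg x)%:R * f x ^+ 2 - \sum_x f x * \sum_y (adj x y)%:R * f y
    = mu * \sum_x f x ^+ 2.
  rewrite mulr_sumr -sumrB; apply: eq_bigr => x _.
  by have := Lf x; set s := \sum_y _ => Lx; rewrite expr2 [RHS]mulrA -Lx; ring.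
have: 0 <= \sum_x \sum_y (adj x y)%:R * (f x + - 1 * f y) ^+ 2.
  by do 2!apply: sumr_ge0 => ? _; rewrite mulr_ge0 ?ler0n ?sqr_ge0.
by rewrite E; lra.
Qed.

(** The case e = 1: regularity makes D + A act on the eigenvector as 2k - mu. This keeps the
    discriminants in (iii) nonnegative. *)
Lemma laplacian_root_le k mu : regular k G ->
  root (char_poly (laplacian R G)) mu -> mu <= 2 * k%:R.
Proof.
move=> reg /laplacian_eigenvector[f f0 Lf].
rewrite -subr_ge0 -(pmulr_lge0 _ f0).
have := @sum_adj_sqr f 1; rewrite expr1n => /(_ erefl) E.
have S : \sum_x (deg x)%:R * f x ^+ 2 + \sum_x f x * \sum_y (adj x y)%:R * f y
    = (2 * k%:R - mu) * \sum_x f x ^+ 2.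
  rewrite mulr_sumr -big_split; apply: eq_bigr => x _ /=.
  have := Lf x; rewrite reg; set s := \sum_y _ => Lx.
  have -> : s = k%:R * f x - mu * f x by rewrite -Lx; ring.
  by ring.
have: 0 <= \sum_x \sum_y (adj x y)%:R * (f x + 1 * f y) ^+ 2.
  by do 2!apply: sumr_ge0 => ? _; rewrite mulr_ge0 ?ler0n ?sqr_ge0.
by rewrite E; lra.
Qed.

End Degree.

(** * Edges and the incidence matrix of a regular graph *)

Section Incidence.
Variables (R : rcfType) (G : sgraph).

Local Notation edgeT := (edge G : finType).

Lemma big_edge (V : nmodType) (F : {set G} -> V) :
  \sum_(e : edge G) F (val e) = \sum_(e in edges G) F e.
Proof. by rewrite (big_sub (mem (edges G))). Qed.

Lemma mem_edges (x y : G) : ([set x; y] \in edges G) = adj x y.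
Proof.
apply/imsetP/idP => [[[u v] /= + E]|xy]; last by exists (x, y); rewrite ?inE.
rewrite inE /= => uv.
have: x \in [set u; v] by rewrite -E set21.
have: y \in [set u; v] by rewrite -E set22.
have: u \in [set x; y] by rewrite E set21.
have: v \in [set x; y] by rewrite E set22.
have uNv : u != v by apply: contraTneq uv => ->; rewrite adj_irrefl.
rewrite !inE => vxy uxy /orP[]/eqP yE /orP[]/eqP xE; subst x y => //.
- by move: vxy; rewrite eq_sym orbb (negPf uNv).
- by rewrite adj_sym.
- by move: uxy; rewrite orbb (negPf uNv).
Qed.

Lemma edgesP (e : {set G}) :
  reflect (exists x y, adj x y /\ e = [set x; y]) (e \in edges G).
Proof.
apply: (iffP imsetP) => [[[u v] + ->]|[x [y [xy ->]]]].
  by rewrite inE => uv; exists u, v.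
by exists (x, y); rewrite ?inE.
Qed.

Lemma card_edge (e : {set G}) : e \in edges G -> #|e| = 2%N.
Proof.
case/edgesP => x [y [xy ->]]; rewrite cards2.
by case: eqVneq xy => // ->; rewrite adj_irrefl.
Qed.

Lemma edge_other (e : {set G}) x : e \in edges G -> x \in e ->
  exists2 y, adj x y & e = [set x; y].
Proof.
case/edgesP => u [v [uv ->]]; rewrite !inE => /orP[]/eqP->; first by exists v.
by exists u; rewrite ?(adj_sym v) // setUC.
Qed.

(** The map sending y to {x, y} is a bijection from the neighbours of x to the edges at x. *)
Lemma sum_incident (x : G) : (\sum_(e in edges G) (x \in e))%N = deg x.
Proof.
rewrite -big_mkcondr /= sum1dep_card /deg.
rewrite -(@card_in_imset _ _ (fun y => [set x; y])); last first.
  move=> y z; rewrite !inE => xy xz E.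
  have: y \in [set x; z] by rewrite -E set22.
  by rewrite !inE => /orP[]/eqP // yx; rewrite yx adj_irrefl in xy.
apply: eq_card => e; rewrite !inE; apply/andP/imsetP => [[eG xe]|[y]].
  by have [y xy ->] := edge_other eG xe; exists y; rewrite ?inE.
by rewrite inE => xy ->; rewrite mem_edges set21.
Qed.

Lemma sum_incident2 (x y : G) : x != y ->
  (\sum_(e in edges G) ((x \in e) && (y \in e)))%N = adj x y.
Proof.
move=> xy; rewrite -big_mkcondr /= sum1dep_card.
have -> : [set e : {set G} | (e \in edges G) && ((x \in e) && (y \in e))]
        = if adj x y then [set [set x; y]] else set0.
  apply/setP => e; rewrite !inE; apply/andP/idP => [[eG /andP[xe ye]]|].
    have [z xz E] := edge_other eG xe.
    move: ye; rewrite E !inE eq_sym (negPf xy) /= => /eqP yz.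
    by rewrite yz xz inE.
  case: ifP => [axy|_]; last by rewrite inE.
  by rewrite inE => /eqP->; rewrite mem_edges axy set21 set22.
by case: ifP => _; rewrite ?cards1 ?cards0.
Qed.

Definition incidence_mx : 'M[R]_(#|G|, #|edgeT|) :=
  \matrix_(i, j) (enum_val i \in val (@enum_val edgeT predT j))%:R.

Lemma card_edge_type : #|edgeT| = #|edges G|.
Proof. by rewrite card_sig; apply: eq_card. Qed.

Variable k : nat.
Hypothesis reg : regular k G.

(** Double counting of incident vertex-edge pairs. *)
Lemma handshake : (#|G| * k = 2 * #|edges G|)%N.
Proof.
transitivity (\sum_(x : G) \sum_(e in edges G) (x \in e))%N.
  rewrite -sum_nat_const; apply: eq_bigr => x _.
  by rewrite sum_incident reg.
rewrite exchange_big /= mulnC -sum_nat_const; apply: eq_bigr => e eG.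
by rewrite -(card_edge eG) -sum1_card [RHS]big_mkcond.
Qed.

Lemma incidence_const q :
  incidence_mx *m const_mx 1 = const_mx k%:R :> 'M_(#|G|, q).
Proof.
apply/matrixP => i j; rewrite !mxE.
under eq_bigr => l _ do rewrite !mxE mulr1.
rewrite (sum_enum_val (fun e : edge G => (enum_val i \in val e)%:R)).
rewrite (big_edge (fun e => (enum_val i \in e)%:R)).
by rewrite -natr_sum sum_incident reg.
Qed.

(** Entries of B B^T count common edges: k on the diagonal, adjacency off it. Thus B B^T = k + A,
    and regularity gives A = k - L. *)
Lemma incidence_tr :
  incidence_mx *m incidence_mx^T = (2 * k%:R)%:M - laplacian R G.
Proof.
apply/matrixP => i j; rewrite !mxE -[in RHS]mulr_natr.
under eq_bigr => l _ do rewrite !mxE -natrM mulnb.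
pose inc (e : {set G}) := (enum_val i \in e) && (enum_val j \in e).
rewrite (sum_enum_val (fun e : edge G => (inc (val e))%:R)).
rewrite (big_edge (fun e => (inc e)%:R)) -natr_sum /inc.
have [->|ij] := eqVneq i j; last first.
  rewrite sum_incident2; first by rewrite ?mulr0 ?mulr0n; ring.
  by rewrite (inj_eq enum_val_inj).
under eq_bigr => e _ do rewrite andbb.
by rewrite sum_incident adj_irrefl reg ?mulr1n ?mulr0n; ring.
Qed.

End Incidence.

(** * Spectra as root multisets *)

Lemma horner_char_poly (R : comNzRingType) p (A : 'M[R]_p) x :
  (char_poly A).[x] = \det (x%:M - A).
Proof.
rewrite -[LHS]/(horner_eval x _) -det_map_mx; congr (\det _).
apply/matrixP => i j; rewrite !mxE /= /horner_eval !hornerE.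
by case: (i == j); rewrite ?mulr1n ?mulr0n !hornerE.
Qed.

(** Root multiplicities add over products. No splitting of [q] is assumed; comparing sizes later
    yields it for the quartic. *)
Lemma perm_mroots (R : rcfType) (s l : seq R) (q : {poly R}) : q != 0 ->
  \prod_(x <- s) ('X - x%:P) = \prod_(x <- l) ('X - x%:P) * q ->
  perm_eq s (l ++ mroots q).
Proof.
move=> q0 E; apply/allP => x _ /=; rewrite count_cat count_mroots //.
have /(congr1 (mup x)) := E; rewrite mupM ?q0 ?monic_neq0 ?monic_prod_XsubC //.
by rewrite !mu_prod_XsubC => ->.
Qed.

(** The product (p - q) w vanishes at every point of an infinite field. This extends the elimination
    from generic x to a polynomial identity. *)
Lemma poly_eq_off (R : rcfType) (p q w : {poly R}) : w != 0 ->
  (forall x, w.[x] != 0 -> p.[x] = q.[x]) -> p = q.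
Proof.
move=> w0 E; apply/eqP; rewrite -subr_eq0.
suff: (p - q) * w == 0 by rewrite mulf_eq0 (negPf w0) orbF.
set r := _ * w; apply/negPn/negP => r0.
have rx x : root r x.
  rewrite /root !hornerE; have [->|/E->] := eqVneq w.[x] 0; first by rewrite mulr0.
  by rewrite subrr mul0r.
(* These are [size r] distinct roots, one more than the degree allows. *)
pose s : seq R := [seq i%:R | i <- iota 0 (size r)].
suff /(max_poly_roots r0) : uniq s.
  by rewrite size_map size_iota ltnn => H; apply/notF/H/allP => y _.
by rewrite map_inj_uniq ?iota_uniq // => i j /eqP; rewrite eqr_nat => /eqP.
Qed.

Section LaplacianSpectrum.
Variables (R : rcfType) (G : sgraph).

Lemma char_poly_laplacian :
  char_poly (laplacian R G) = \prod_(x <- laplacian_spectrum R G) ('X - x%:P).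
Proof. by rewrite spectrum_sym // laplacian_sym. Qed.

Lemma size_laplacian_spectrum : size (laplacian_spectrum R G) = #|G|.
Proof.
have := size_char_poly (laplacian R G).
by rewrite char_poly_laplacian size_prod_XsubC => -[].
Qed.

Lemma mem_laplacian_spectrum x :
  (x \in laplacian_spectrum R G) = root (char_poly (laplacian R G)) x.
Proof. by rewrite char_poly_laplacian root_prod_XsubC. Qed.

(** The all-ones vector has eigenvalue 0, and in a sorted list of nonnegative numbers 0 comes first;
    so [behead] holds the eigenvalues from index 2 on. *)
Lemma laplacian_spectrum0 : (0 < #|G|)%N ->
  laplacian_spectrum R G = 0 :: behead (laplacian_spectrum R G).
Proof.
move=> G0; have: 0 \in laplacian_spectrum R G.
  rewrite mem_laplacian_spectrum -eigenvalue_root_char; apply/eigenvalueP.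
  exists (const_mx 1); last first.
    by apply/rV0Pn; exists (Ordinal G0); rewrite mxE oner_eq0.
  by rewrite scale0r -laplacian_sym -trmx_const -trmx_mul laplacian_const trmx0.
have: sorted <=%R (laplacian_spectrum R G) by exact: mroots_sorted.
have: {in laplacian_spectrum R G, forall x, 0 <= x}.
  by move=> x; rewrite mem_laplacian_spectrum; exact: laplacian_root_ge0.
case: (laplacian_spectrum R G) => [|a s] //= pos.
rewrite (path_sortedE le_trans) => /andP[/allP amin _].
rewrite inE => /predU1P[<- //|/amin a0]; congr (_ :: _).
by apply/eqP; rewrite eq_le a0 pos ?mem_head.
Qed.

Lemma map_lambda (T : Type) (g : R -> T) :
  [seq g (lambda R G i) | i <- index_iota 2 #|G|.+1]
  = [seq g x | x <- behead (laplacian_spectrum R G)].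
Proof.
rewrite (map_comp g (lambda R G)); congr map.
rewrite /index_iota subSS -drop1 -[in RHS](take_size (drop 1 _)) size_drop.
rewrite size_laplacian_spectrum -(@map_nth_iota _ 0) ?size_laplacian_spectrum //.
by rewrite (iotaDl 1 1) -map_comp.
Qed.

Lemma size_behead_spectrum :
  size (behead (laplacian_spectrum R G)) = #|G|.-1.
Proof. by rewrite size_behead size_laplacian_spectrum. Qed.

Lemma det_sub_laplacian (x : R) : (0 < #|G|)%N ->
  \det (x%:M - laplacian R G)
  = x * \prod_(a <- behead (laplacian_spectrum R G)) (x - a).
Proof.
move=> G0; rewrite -horner_char_poly char_poly_laplacian laplacian_spectrum0 //=.
rewrite big_cons !hornerE horner_prod subr0; congr (_ * _).
by apply: eq_bigr => a _; rewrite !hornerE.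
Qed.

Lemma det_add_laplacian (x : R) : (0 < #|G|)%N ->
  \det (x%:M + laplacian R G)
  = x * \prod_(a <- behead (laplacian_spectrum R G)) (x + a).
Proof.
(* One sign from each row: the first goes to the factor x, the others to the remaining factors. *)
move=> G0; have -> : x%:M + laplacian R G = -1 *: ((- x)%:M - laplacian R G).
  by rewrite scaleN1r opprB [RHS]addrC raddfN /= opprK.
have neg (s : seq R) : (-1) ^+ size s * \prod_(a <- s) (- x - a) = \prod_(a <- s) (x + a).
  elim: s => [|a s IH]; first by rewrite !big_nil mulr1.
  by rewrite !big_cons -IH exprS /=; ring.
rewrite detZ det_sub_laplacian // -neg size_behead_spectrum -{1}(prednK G0) exprS.
move: (_ ^+ _) (\prod_(_ <- _) _) => u v.
by ring.
Qed.

End LaplacianSpectrum.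

(** * The Laplacian of the join as a block matrix *)

Lemma ord_sum4_ind p1 p2 q1 q2 (P : 'I_((p1 + p2) + (q1 + q2)) -> Prop) :
  (forall a, P (lshift _ (lshift _ a))) -> (forall a, P (lshift _ (rshift _ a))) ->
  (forall a, P (rshift _ (lshift _ a))) -> (forall a, P (rshift _ (rshift _ a))) ->
  forall i, P i.
Proof.
move=> Pll Plr Prl Prr i.
by case: (split_ordP i) => j ->; case: (split_ordP j) => l ->.
Qed.

Section SDJ.
Variables (R : rcfType) (G G1 G2 : sgraph) (k : nat).
Hypothesis reg : regular k G.

Local Notation edgeT := (edge G : finType).
Local Notation sdj := (subdivision_double_join G G1 G2).

Lemma deg_sdj (u : sdj) : deg u =
  match u with
  | inl (inl a) => k + #|G1| | inl (inr e) => 2 + #|G2|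
  | inr (inl a) => deg a + #|G| | inr (inr b) => deg b + #|edgeT| end%N.
Proof.
rewrite deg_sum !big_sumType /=.
case: u => [[x|e]|[a|b]] /=; rewrite ?sum_nat_const ?big1_eq ?muln0 ?muln1.
- rewrite add0n addn0; congr (_ + _)%N.
  by rewrite (big_edge (fun e => nat_of_bool (x \in e))) sum_incident reg.
- rewrite addn0 add0n; congr (_ + _)%N.
  by rewrite -(card_edge (valP e)) -sum1_card [RHS]big_mkcond.
- by rewrite !addn0 addnC -deg_sum.
- by rewrite !add0n addnC -deg_sum.
Qed.

(** Enumerates the join in the cell order of [join_char_mx]. *)
Definition sdj_index (i : 'I_((#|G| + #|edgeT|) + (#|G1| + #|G2|))) : sdj :=
  match split i with
  | inl j => inl match split j with
             | inl a => inl (enum_val a) | inr e => inr (@enum_val edgeT predT e) end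
  | inr j => inr match split j with
             | inl a => inl (enum_val a) | inr b => inr (enum_val b) end
  end.

Lemma sdj_indexE :
  (forall a, sdj_index (lshift _ (lshift _ a)) = inl (inl (enum_val a)))
  * (forall e, sdj_index (lshift _ (rshift _ e)) = inl (inr (@enum_val edgeT predT e)))
  * (forall a, sdj_index (rshift _ (lshift _ a)) = inr (inl (enum_val a)))
  * (forall b, sdj_index (rshift _ (rshift _ b)) = inr (inr (enum_val b))).
Proof.
rewrite /sdj_index; split; [split; [split|]|] => u.
- by rewrite (unsplitK (inl _)) (unsplitK (inl _)).
- by rewrite (unsplitK (inl _)) (unsplitK (inr _)).
- by rewrite (unsplitK (inr _)) (unsplitK (inl _)).
- by rewrite (unsplitK (inr _)) (unsplitK (inr _)).
Qed.

Lemma sdj_index_bij : bijective sdj_index.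
Proof.
exists (fun u => match u with
  | inl (inl a) => lshift _ (lshift _ (enum_rank a))
  | inl (inr e) => lshift _ (rshift _ (@enum_rank edgeT e))
  | inr (inl a) => rshift _ (lshift _ (enum_rank a))
  | inr (inr b) => rshift _ (rshift _ (enum_rank b)) end).
- by move=> i; elim/ord_sum4_ind: i => i; rewrite sdj_indexE enum_valK.
- by move=> [[a|e]|[a|b]]; rewrite sdj_indexE enum_rankK.
Qed.

Lemma det_sub_sdj (x : R) :
  \det (x%:M - laplacian R sdj)
  = \det (join_char_mx k%:R x (incidence_mx R G) (laplacian R G1) (laplacian R G2)).
Proof.
(* The entries of x - L as a function of two vertices, independent of any enumeration. *)
pose F (u v : sdj) : R := (u == v)%:R * (x - (deg u)%:R) + (adj u v)%:R.
transitivity (\det (\matrix_(i < #|sdj|, j < #|sdj|) F (enum_val i) (enum_val j))).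
  congr (\det _); apply/matrixP => i j.
  rewrite mxE [X in _ + X]mxE laplacianE !mxE /F (inj_eq enum_val_inj).
  by rewrite -mulr_natr; ring.
rewrite (det_reindex _ sdj_index_bij); congr (\det _); apply/matrixP => i j.
rewrite mxE /F (inj_eq (bij_inj sdj_index_bij)) deg_sdj /join_char_mx.
elim/ord_sum4_ind: i => i; elim/ord_sum4_ind: j => j;
  rewrite !eq_shift sdj_indexE sdj_indexE;
  rewrite ?(block_mxEul, block_mxEur, block_mxEdl, block_mxEdr).
all: rewrite ?laplacianE ?mxE /= ?mul0r ?add0r ?addr0 //.
all: rewrite ?natrD mulr_natl opprD ?addrA //.
all: by rewrite opprB addrCA -mulrnBl [RHS]addrC [in LHS]addrAC.
Qed.

End SDJ.

(** * Assembling the spectrum *)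

Lemma quadratic_neq0 (R : idomainType) (a b c : R) :
  ('X - a%:P) * ('X - b%:P) - c%:P != 0.
Proof.
rewrite subr_eq0; apply/eqP => /(congr1 (fun p : {poly R} => size p)).
rewrite size_Mmonic ?monicXsubC ?monic_neq0 ?monicXsubC // !size_XsubC.
by rewrite size_polyC; case: (c != 0).
Qed.

Lemma quadratic_roots (R : rcfType) (s p d x : R) : 0 <= d ->
  s ^+ 2 - d = 4 * p ->
  (x - (s + Num.sqrt d) / 2) * (x - (s - Num.sqrt d) / 2) = x ^+ 2 - s * x + p.
Proof.
move=> d0 E; have D := sqr_sqrtr d0.
have -> : (x - (s + Num.sqrt d) / 2) * (x - (s - Num.sqrt d) / 2)
  = x ^+ 2 - s * x + (s ^+ 2 - Num.sqrt d ^+ 2) / 4 by field.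
by rewrite D E; field.
Qed.

Theorem theorem4 (R : rcfType) (G G1 G2 : sgraph) (k n m n1 n2 : nat)
    (hconn : connected G) (hreg : regular k G)
    (hn : #|G| = n) (hm : #|edges G| = m) (hmn : (n <= m)%N)
    (hn1 : #|G1| = n1) (hn2 : #|G2| = n2)
    (hn1_ge1 : (1 <= n1)%N) (hn2_ge1 : (1 <= n2)%N) :
  let k' : R := k%:R in let n' : R := n%:R in let m' : R := m%:R in
  let n1' : R := n1%:R in let n2' : R := n2%:R in
  let disc i := (n1' + k' - n2' - 2) ^+ 2 + 4 * (2 * k' - lambda R G i) in
  let quartic : {poly R} :=
    'X * ('X^3 - (m' + n' + n1' + k' + n2' + 2) *: 'X^2
          + (2 * m' + (n1' + k' + n') * (m' + n2' + 2)
             + n' * k' - 2 * k') *: 'X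
          + (2 * (n' + m') * k' - 2 * (n1' + k' + n') * m'
             - n' * k' * (m' + n2' + 2))%:P) in
  size (mroots quartic) = 4%N /\
  perm_eq (laplacian_spectrum R (subdivision_double_join G G1 G2))
    ([seq lambda R G1 i + n' | i <- index_iota 2 n1.+1]
     ++ [seq lambda R G2 i + m' | i <- index_iota 2 n2.+1]
     ++ [seq (n1' + k' + n2' + 2 + Num.sqrt (disc i)) / 2
          | i <- index_iota 2 n.+1]
     ++ [seq (n1' + k' + n2' + 2 - Num.sqrt (disc i)) / 2
          | i <- index_iota 2 n.+1]
     ++ nseq (m - n) (n2' + 2)
     ++ mroots quartic).
Proof.
rewrite -card_edge_type in hm; subst n m n1 n2.
set n := #|G| in hmn *; set m := #|(edge G : finType)| in hmn *.
set n1 := #|G1| in hn1_ge1 *; set n2 := #|G2| in hn2_ge1 *.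
move=> k' n' m' n1' n2' disc q.
have [n_gt0 _] := hconn.
have card_sdj : #|subdivision_double_join G G1 G2| = (n + m + (n1 + n2))%N.
  by rewrite !card_sum.
have nk : n%:R * k%:R = 2 * m%:R :> R.
  by rewrite -!natrM handshake // /m card_edge_type.
pose s := n1' + k' + n2' + 2.
pose d a := (n1' + k' - n2' - 2) ^+ 2 + 4 * (2 * k' - a).
have -> : [seq lambda R G1 i + n' | i <- index_iota 2 n1.+1]
        = [seq a + n' | a <- behead (laplacian_spectrum R G1)].
  by rewrite (map_lambda _ (fun a => a + n')).
have -> : [seq lambda R G2 i + m' | i <- index_iota 2 n2.+1]
        = [seq a + m' | a <- behead (laplacian_spectrum R G2)].
  by rewrite (map_lambda _ (fun a => a + m')).
have -> : [seq (n1' + k' + n2' + 2 + Num.sqrt (disc i)) / 2 | i <- index_iota 2 n.+1]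
        = [seq (s + Num.sqrt (d a)) / 2 | a <- behead (laplacian_spectrum R G)].
  by rewrite -(map_lambda _ (fun a => (s + Num.sqrt (d a)) / 2)).
have -> : [seq (n1' + k' + n2' + 2 - Num.sqrt (disc i)) / 2 | i <- index_iota 2 n.+1]
        = [seq (s - Num.sqrt (d a)) / 2 | a <- behead (laplacian_spectrum R G)].
  by rewrite -(map_lambda _ (fun a => (s - Num.sqrt (d a)) / 2)).
set l1 := [seq _ | a <- _]; set l2 := [seq _ | a <- _]; set l3 := [seq _ | a <- _].
set l4 := [seq _ | a <- _]; set l5 := nseq _ _.
pose l := l1 ++ l2 ++ l3 ++ l4 ++ l5.
(* The list [l] gathers families (i) to (iv); the quartic stays as one unsplit factor. *)
suff E : char_poly (laplacian R (subdivision_double_join G G1 G2))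
       = \prod_(x <- l) ('X - x%:P) * q.
  have q0 : q != 0.
    apply/eqP => q0; move: E; rewrite q0 mulr0; apply/eqP.
    by rewrite monic_neq0 ?char_poly_monic.
  move: E; rewrite char_poly_laplacian => /(perm_mroots q0) pE.
  split; last by rewrite /l -!catA in pE.
  (* The list [l] has (n1-1) + (n2-1) + 2(n-1) + (m-n) entries, four fewer than the join has
     vertices, so the quartic supplies four roots. *)
  have := perm_size pE; rewrite size_laplacian_spectrum card_sdj /l !size_cat.
  rewrite size_nseq !size_map !size_behead_spectrum.
  by move: n_gt0 hmn hn1_ge1 hn2_ge1; move: (size (mroots q)) => t; clear; lia.
(* The product of all quantities that [det_join] requires to be nonzero. *)
pose w : {poly R} := ('X - n'%:P) * ('X - m'%:P) * ('X - (2 + n2')%:P)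
  * (('X - (k' + n1')%:P) * ('X - (2 + n2')%:P) - (2 * k')%:P)
  * (('X - (2 + n2')%:P) * ('X - m'%:P) - (n2' * m')%:P).
have w0 : w != 0 by rewrite !mulf_neq0 ?polyXsubC_eq0 ?quadratic_neq0.
apply: (poly_eq_off w0) => x wx.
have /and5P[xn xm b0 y0 z0] :
    [&& x - n' != 0, x - m' != 0, x - (2 + n2') != 0,
        (x - (k' + n1')) * (x - (2 + n2')) - 2 * k' != 0
      & (x - (2 + n2')) * (x - m') - n2' * m' != 0].
  move: wx; rewrite /w !(hornerM, hornerD, hornerN, hornerX, hornerC).
  by rewrite !mulf_eq0 !negb_or -!andbA.
have Eq : q.[x] = quartic_val k' n' m' n1' n2' x.
  by rewrite !(hornerM, hornerD, hornerN, hornerX, hornerXn, hornerZ, hornerC).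
rewrite hornerM Eq horner_char_poly (det_sub_sdj _ _ hreg).
have ge0 a : a \in behead (laplacian_spectrum R G) -> 0 <= d a.
  move=> /mem_behead; rewrite mem_laplacian_spectrum => /(laplacian_root_le hreg) ak.
  by rewrite addr_ge0 ?sqr_ge0 // mulr_ge0 // subr_ge0.
have := det_join (F := R) (x := x) (k := k') (B := incidence_mx R G) (L := laplacian R G)
  (L1 := laplacian R G1) (L2 := laplacian R G2).
rewrite -/n -/m -/n1 -/n2 -/n' -/m' -/n1' -/n2'.
have -> : x - k' - n1' = x - (k' + n1') by ring.
have -> : x - 2 - n2' = x - (2 + n2') by ring.
set b := x - (2 + n2') in b0 y0 z0 *; set y := _ - 2 * k' in y0 *.
move=> /(_ nk).
move=> /(_ (incidence_const R hreg _) (incidence_tr R hreg)).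
move=> /(_ (laplacian_const _ _ _) (laplacian_const _ _ _) (laplacian_const _ _ _)).
move=> /(_ xn xm b0 y0 z0).
rewrite !det_sub_laplacian // det_add_laplacian //.
set D := \det _; set P0 := \prod_(a <- _) _; set P1 := \prod_(a <- _) _.
set P2 := \prod_(a <- _) _; set Q := quartic_val _ _ _ _ _ _ => ED.
have -> : (\prod_(a <- l) ('X - a%:P)).[x] = P1 * P2 * P0 * b ^+ (m - n).
  rewrite horner_prod (eq_bigr (fun a => x - a)) => [|a _]; last by rewrite hornerXsubC.
  rewrite /l !big_cat !big_map big_nseq iter_mulr mulr1 /= -/b (addrC n2') -/b.
  rewrite !mulrA -[_ * _ * \prod_(a <- _) (x - (s - _) / 2)]mulrA -big_split /=.
  congr (_ * _ * _ * _).
  - by apply: eq_bigr => a _; ring.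
  - by apply: eq_bigr => a _; ring.
  - apply: eq_big_seq => a /ge0 da.
    (* The roots paired from [l3] and [l4] have sum s and product p = (s^2 - d(a))/4, so their
       quadratic is y + a. *)
    rewrite (quadratic_roots (p := (k' + n1') * (2 + n2') - 2 * k' + a)) //.
      by rewrite /y /b /s; ring.
    by rewrite /s /d; ring.
have c0 : y * (x - n') * (x - m') * b ^+ n != 0 by rewrite !mulf_neq0 ?expf_neq0.
(* Splitting b^m as b^n b^(m-n), where n <= m is used, leaves the power for family (iv); y, x - n
   and x - m match the eigenvalue-0 factors of the three determinants. *)
apply: (mulfI c0); rewrite ED -{1}(subnKC hmn) exprD.
move: (b ^+ n) (b ^+ (m - n)) => bn bmn.
by clearbody P0 P1 P2 Q y n' m'; ring.
Qed.
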